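(* Let $R=k[x_1,\ldots,x_n]$ be a standard graded polynomial ring in $n\ge 3$ variables over a field $k$, let $(d,m,\underline{\delta},\underline{\epsilon})$ be latent data, and let $\eta=\begin{bmatrix}A\\ B\end{bmatrix}$ be a $(d,m,\underline{\delta},\underline{\epsilon})$-level matrix over $R$. Order the signed maximal minors of $\eta$ in such a way that $p_1,p_2,p_3$ are the three maximal minors of $\eta$ fixing the lower block $B$. Then the minimal graded free resolution of $J:=\langle p_1,p_2,p_3\rangle\subset R$ is $$0\to \bigoplus_{j=1}^{m-2} R(-d-\delta_{j+2}-\epsilon_j)\xrightarrow{\;B^t\;} \bigoplus_{i=1}^{m} R(-d-\delta_i)\xrightarrow{\;AK\;} R(-d)^3\xrightarrow{\;[p_1\,p_2\,p_3]\;} R,$$ where $K$ is the $m\times m$ skew-symmetric matrix with zero diagonal whose $(i,j)$ entry, for $i\neq j$, is $\sigma_{i,j}\Delta_{i,j}$; here $\Delta_{i,j}=\Delta_{j,i}$ is the maximal minor of $B$ obtained by omitting the $i$th and $j$th columns, $\sigma_{i,j}=(-1)^{i-j}$ for $i<j$, and $\sigma_{j,i}=-\sigma_{i,j}$.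
   Context: For a matrix $M$ over $R$, $I_t(M)$ denotes the ideal generated by the $t\times t$ minors of $M$, and $\mathrm{ht}$ denotes height (codimension). The zero polynomial is considered homogeneous of any degree. Latent data $(d,m,\underline{\delta},\underline{\epsilon})$: integers $d\ge 1$, $m\ge 3$, $1\le\delta_1\le\cdots\le\delta_m$ and $\epsilon_1,\ldots,\epsilon_{m-2}\ge 1$ such that (1) $\delta_3+\epsilon_1\le\delta_4+\epsilon_2\le\cdots\le\delta_m+\epsilon_{m-2}$; (2) $\delta_1+\delta_2=d+\sum_{j=1}^{m-2}\epsilon_j$; (3) $\delta_i+\delta_j\ge d+1$ for every $1\le i<j\le m$; (4) $\delta_3\le d$. Level matrix: given latent data $(d,m,\underline{\delta},\underline{\epsilon})$, an $(m+1)\times m$ vertical block matrix $\eta=\begin{bmatrix}A\\ B\end{bmatrix}$ over $R$ is $(d,m,\underline{\delta},\underline{\epsilon})$-level if (a) $A=(a_{i,j})$ is a $3\times m$ matrix such that $a_{i,j}$ is a homogeneous polynomial of degree $d-\delta_j$ if $d-\delta_j\ge 0$, and $a_{i,j}=0$ if $d-\delta_j<0$; (b) $B=(b_{i,j})$ is an $(m-2)\times m$ matrix such that $b_{i,j}$ is a homogeneous polynomial of degree $\delta_{i+2}-\delta_j+\epsilon_i$ if $\delta_{i+2}-\delta_j+\epsilon_i>0$, and $b_{i,j}=0$ if $\delta_{i+2}-\delta_j+\epsilon_i\le 0$; (c) $\mathrm{ht}\,I_m(\eta)=2$ and $\mathrm{ht}\,I_{m-2}(B)=3$. The signed maximal minors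 are $p_i=(-1)^{i-1}\det(\eta \text{ with row } i \text{ omitted})$, $1\le i\le m+1$, so that $[p_1\,\cdots\,p_{m+1}]\,\eta=0$; those with $i=1,2,3$ involve all rows of $B$ (they ''fix'' $B$). Matrices act on column vectors. *)

(* Defs.v *)
From mathcomp Require Import all_boot all_order all_algebra.
From mathcomp Require Import mpoly.

Set Implicit Arguments.
Unset Strict Implicit.
Unset Printing Implicit Defensive.

Import GRing.Theory.
Local Open Scope ring_scope.

(* Ideals are Prop-valued predicates: membership in a generated ideal of a
   polynomial ring is not a boolean notion, so ring_quotient's idealr does not
   apply. *)
Section Ideals.

Variable R : comNzRingType.
Implicit Types I P : R -> Prop.

Definition is_ideal I : Prop :=
  [/\ I 0, forall x y, I x -> I y -> I (x + y) & forall a x, I x -> I (a * x)].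

Definition ideal_le I P : Prop := forall x, I x -> P x.

Definition prime_ideal P : Prop :=
  [/\ is_ideal P, ~ P 1 & forall x y, P (x * y) -> P x \/ P y].

Definition ideal_gen (G : R -> Prop) : R -> Prop :=
  fun x => forall I, is_ideal I -> ideal_le G I -> I x.

(* Some chain Q_0 < Q_1 < ... < Q_h of prime ideals ends at Q_h = P. *)
Definition prime_chain_to P (h : nat) : Prop :=
  exists Q : nat -> R -> Prop,
  [/\ forall i, (i <= h)%N -> prime_ideal (Q i),
      forall i, (i < h)%N ->
        ideal_le (Q i) (Q i.+1) /\ ~ ideal_le (Q i.+1) (Q i)
    & forall x, Q h x <-> P x].

Definition prime_height P (h : nat) : Prop :=
  prime_chain_to P h /\ ~ prime_chain_to P h.+1.

(* h is the minimum of the heights of the primes containing I; in particular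
   this fails for the unit ideal. *)
Definition height I (h : nat) : Prop :=
  (exists P, [/\ prime_ideal P, ideal_le I P & prime_height P h]) /\
  (forall P, prime_ideal P -> ideal_le I P -> prime_chain_to P h).

Definition is_minor (a b t : nat) (M : 'M[R]_(a, b)) (x : R) : Prop :=
  exists (f : 'I_t -> 'I_a) (g : 'I_t -> 'I_b),
  [/\ {homo f : i j / (i < j)%N}, {homo g : i j / (i < j)%N}
    & x = \det (mxsub f g M)].

Definition minors_ideal (a b t : nat) (M : 'M[R]_(a, b)) : R -> Prop :=
  ideal_gen (is_minor t M).

Definition injective_mx (a b : nat) (M : 'M[R]_(a, b)) : Prop :=
  forall v : 'cV[R]_b, M *m v = 0 -> v = 0.

Definition exact_at (a b c : nat) (M : 'M[R]_(a, b)) (N : 'M[R]_(b, c)) : Prop :=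
  forall v : 'cV[R]_b, M *m v = 0 <-> exists u : 'cV[R]_c, v = N *m u.

End Ideals.

Section Graded.

Variables (n : nat) (k : fieldType).
Local Notation R := {mpoly k[n]}.

(* v is homogeneous of degree e in the graded free module \bigoplus_i R(-s i). *)
Definition homog_elt (a : nat) (s : 'I_a -> nat) (e : nat) (v : 'cV[R]_a) : Prop :=
  forall i, if (s i <= e)%N then v i 0 \is (e - s i)%N.-homog else v i 0 == 0.

Definition graded_map (a b : nat) (s : 'I_a -> nat) (t : 'I_b -> nat)
    (M : 'M[R]_(a, b)) : Prop :=
  forall e v, homog_elt t e v -> homog_elt s e (M *m v).

Definition irrelevant_ideal : R -> Prop :=
  ideal_gen (fun x => exists i : 'I_n, x = 'X_i).

Definition minimal_map (a b : nat) (M : 'M[R]_(a, b)) : Prop :=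
  forall (v : 'cV[R]_b) i, irrelevant_ideal ((M *m v) i 0).

(* 0 -> \bigoplus_j R(-s3 j) --M3--> \bigoplus_j R(-s2 j) --M2-->
     \bigoplus_j R(-s1 j) --M1--> R, with image of M1 equal to J. *)
Record minimal_graded_free_resolution (J : R -> Prop) (b1 b2 b3 : nat)
    (s1 : 'I_b1 -> nat) (s2 : 'I_b2 -> nat) (s3 : 'I_b3 -> nat)
    (M1 : 'M[R]_(1, b1)) (M2 : 'M[R]_(b1, b2)) (M3 : 'M[R]_(b2, b3)) : Prop :=
  MinimalGradedFreeResolution {
    res_graded1 : graded_map (fun _ => 0%N) s1 M1;
    res_graded2 : graded_map s1 s2 M2;
    res_graded3 : graded_map s2 s3 M3;
    res_image   : forall x, J x <-> exists v : 'cV[R]_b1, x = (M1 *m v) 0 0;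
    res_exact1  : exact_at M1 M2;
    res_exact2  : exact_at M2 M3;
    res_inj     : injective_mx M3;
    res_min1    : minimal_map M1;
    res_min2    : minimal_map M2;
    res_min3    : minimal_map M3
  }.

End Graded.

(* Throughout, m = r + 2, and indices start at 0: delta_{j+2} in 1-based
   notation, for 1 <= j <= m - 2, is delta (rshift 2 j) with j : 'I_r. *)
Record latent_data (d r : nat) (delta : 'I_r.+2 -> nat) (eps : 'I_r -> nat) : Prop :=
  LatentData {
    latent_d     : (1 <= d)%N;
    latent_m     : (3 <= r.+2)%N;
    latent_delta : forall i, (1 <= delta i)%N;
    latent_mono  : forall i j : 'I_r.+2, (i <= j)%N -> (delta i <= delta j)%N;
    latent_eps   : forall j, (1 <= eps j)%N;
    latent1 : forall i j : 'I_r, (i <= j)%N ->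
      (delta (rshift 2 i) + eps i <= delta (rshift 2 j) + eps j)%N;
    latent2 : (delta (inord 0) + delta (inord 1) = d + \sum_(j < r) eps j)%N;
    latent3 : forall i j : 'I_r.+2, (i < j)%N -> (d + 1 <= delta i + delta j)%N;
    latent4 : (delta (inord 2) <= d)%N
  }.

Section Level.

Variables (n : nat) (k : fieldType) (d r : nat).
Variables (delta : 'I_r.+2 -> nat) (eps : 'I_r -> nat).
Local Notation R := {mpoly k[n]}.
Implicit Types (A : 'M[R]_(3, r.+2)) (B : 'M[R]_(r, r.+2)).

Record level_matrix A B : Prop := LevelMatrix {
  level_a : forall l j,
    if (delta j <= d)%N then A l j \is (d - delta j)%N.-homog else A l j == 0;
  level_b : forall i j,
    if (delta j < delta (rshift 2 i) + eps i)%N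
    then B i j \is (delta (rshift 2 i) + eps i - delta j)%N.-homog
    else B i j == 0;
  level_ht_eta : height (minors_ideal r.+2 (col_mx A B)) 2;
  level_ht_B   : height (minors_ideal r B) 3
}.

(* The type cast uses that (3 + r).-1 and r.+2 are convertible. *)
Definition signed_minor A B (i : 'I_(3 + r)) : R :=
  (-1) ^+ i * \det (row' i (col_mx A B) : 'M[R]_(r.+2)).

Definition fixing_minors A B : 'rV[R]_3 :=
  \row_(i < 3) signed_minor A B (lshift r i).

(* If i != j, then j = lift i j' for a unique j'; removing column i and then
   column j' removes the original columns i and j. *)
Definition Delta B (i j : 'I_r.+2) : R :=
  if unlift i j is Some j' then \det (col' j' (col' i B)) else 0.

Definition sigma (i j : 'I_r.+2) : R :=
  if (i < j)%N then (-1) ^+ (j - i) else - (-1) ^+ (i - j).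

Definition Kmx B : 'M[R]_(r.+2) :=
  \matrix_(i, j) (if i == j then 0 else sigma i j * Delta B i j).

End Level.

(* Main.v *)
Require Import Defs.
From HB Require Import structures.
From mathcomp Require Import all_boot all_order all_algebra.
From mathcomp Require Import perm mpoly.
From mathcomp Require boolp classical_sets.
From mathcomp Require Import zify ring.

(** The resolution splices two classical exact complexes. Write [p] for the row of
    all the signed maximal minors of [eta]. Since [eta] has an ideal of maximal
    minors of height 2, the Hilbert-Burch theorem ([hilbert_burch]) says that the
    syzygies of [p] are the combinations of the columns of [eta]. Since the
    maximal minors of [B] have height 3, the Buchsbaum-Rim complex
      [0 -> R^r --B^T--> R^(r+2) --K--> R^(r+2) --B--> R^r]
    is exact ([buchsbaum_rim]). A syzygy of [p_1, p_2, p_3], extended by zeros, is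
    a syzygy of [p], hence [eta u] with [B u = 0]; thus [u = K w], and the syzygy is
    [A K w]. Conversely [p_1, p_2, p_3] kill [A K] because [B K = 0]. Finally, if
    [A K w = 0] then [eta K w = 0], so [K w = 0] as [eta] is injective, and [w] is
    in the image of [B^T].

    Both classical theorems are proved in the same way. Every maximal minor
    annihilates the homology, by Cramer's rule; in a domain it is enough to look at
    a nonzero minor, whose rows or columns determine everything. When the complex
    is exact further to the left, an annihilator that contains a regular sequence
    of length two, respectively three, forces the homology to vanish
    ([regular2_image], [regular3_image]).

    What remains is that an ideal [I] of height at least [h] in [k[x_1..x_n]]
    contains a regular sequence of length [h] ([regular_of_height]). The link
    between the two notions is algebraic dependence. If [n - h + 1] elements [y]
    satisfied no nontrivial relation [F(y)] in [I], some prime containing [I]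
    would keep them independent; a chain of primes of length [h] below it would
    produce [n + 1] independent elements of [k[x_1..x_n]], which do not exist
    ([height_dependence]). This dependence property is all that an induction
    on [n] needs: an element of [I] is made monic in one variable by Nagata's change
    of coordinates, and the property passes to the contraction of [I] to the other
    variables ([regular_of_dependence]).

    The degrees follow from giving row and column degrees to [eta], for which every
    determinant is homogeneous; minimality holds because all entries of the three
    matrices have positive degree or are zero. *)

Set Implicit Arguments.
Unset Strict Implicit.
Unset Printing Implicit Defensive.

Import GRing.Theory.
Local Open Scope ring_scope.

(** * Algebraic dependence *)

Section AlgebraicDependence.

Variable k : fieldType.

Lemma rmorph_mmap n (S S' : comNzRingType) (g : {rmorphism S -> S'}) (f : k -> S)
    (h : 'I_n -> S) p : g (mmap f h p) = mmap (g \o f) (g \o h) p.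
Proof.
rewrite /mmap rmorph_sum /=; apply: eq_bigr => m _.
rewrite rmorphM /mmap1 rmorph_prod; congr (_ * _).
by apply: eq_bigr => i _; rewrite rmorphXn.
Qed.

Lemma eq_mmap n (S : comNzRingType) (f f' : k -> S) (h h' : 'I_n -> S) p :
  f =1 f' -> h =1 h' -> mmap f h p = mmap f' h' p.
Proof.
by move=> ff' hh'; apply: eq_bigr => m _; rewrite ff' (mmap1_eq m hh').
Qed.

Definition peval n c (y : 'I_c -> {mpoly k[n]}) (F : {mpoly k[c]}) : {mpoly k[n]} :=
  mmap (@mpolyC n k) y F.

HB.instance Definition _ n c (y : 'I_c -> {mpoly k[n]}) :=
  GRing.RMorphism.copy (peval y) (mmap (@mpolyC n k) y).

Lemma pevalX n c (y : 'I_c -> {mpoly k[n]}) i : peval y 'X_i = y i.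
Proof. by rewrite /peval mmapX mmap1U. Qed.

Lemma pevalC n c (y : 'I_c -> {mpoly k[n]}) a : peval y a%:MP = a%:MP.
Proof. by rewrite /peval mmapC. Qed.

Lemma msize_mul_leq n (p q : {mpoly k[n]}) a b :
  (msize p <= a.+1)%N -> (msize q <= b.+1)%N -> (msize (p * q) <= (a + b).+1)%N.
Proof.
have [->|p0] := eqVneq p 0; first by rewrite mul0r msize0.
have [->|q0] := eqVneq q 0; first by rewrite mulr0 msize0.
rewrite msizeM //; move: (msize p) (msize q) => s t; lia.
Qed.

Lemma msize_mmap1_leq n c (y : 'I_c -> {mpoly k[n]}) D m :
  (forall i, (msize (y i) <= D.+1)%N) -> (msize (mmap1 y m) <= (mdeg m * D).+1)%N.
Proof.
move=> yD; rewrite mdegE big_distrl /= /mmap1.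
elim/big_ind2: _ => [|p a q b pa qb|i _]; first by rewrite msize1.
  exact: msize_mul_leq.
elim: (m i) => [|e IHe]; first by rewrite expr0 msize1.
by rewrite exprS mulSn; exact: msize_mul_leq.
Qed.

Definition box_mnm c N (e : {ffun 'I_c -> 'I_N}) : 'X_{1..c} := [multinom e i : nat | i < c].

Lemma box_mnm_inj c N : injective (@box_mnm c N).
Proof.
move=> e f /mnmP ef; apply/ffunP => i; apply/val_inj.
by have := ef i; rewrite !mnmE.
Qed.

(** The monomials in [q] elements with exponents below [M] number [M ^ q], and
    they lie in a space of polynomials of dimension [O(M ^ n)], so for large [M]
    they are linearly dependent. *)
Lemma algebraic_dependence n q (y : 'I_q -> {mpoly k[n]}) :
  (n < q)%N -> exists2 F, F != 0 & peval y F = 0.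
Proof.
move=> nq; pose D := (\max_i msize (y i))%N.
have yD i : (msize (y i) <= D.+1)%N by rewrite ltnW // ltnS /D (leq_bigmax i).
pose M := ((q * D).+1 ^ n).+1; pose L := (q * M * D).+1.
pose A : 'M[k]_(#|{ffun 'I_q -> 'I_M}|, #|{ffun 'I_n -> 'I_L}|) :=
  \matrix_(a, b) (mmap1 y (box_mnm (enum_val a)))@_(box_mnm (enum_val b)).
have ltLM : (L ^ n < M ^ q)%N.
  have LM : (L <= M * (q * D).+1)%N.
    by rewrite /L mulnS [(q * M)%N]mulnC mulnA -addn1 addnC leq_add2r.
  apply: (@leq_ltn_trans (M ^ n * (q * D).+1 ^ n)).
    by rewrite -expnMn; case: (n) => // e; rewrite leq_exp2r.
  apply: (@leq_trans (M ^ n.+1)); last by rewrite leq_pexp2l.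
  by rewrite expnSr ltn_pmul2l ?expn_gt0.
have : kermx A != 0.
  rewrite kermx_eq0 /row_free neq_ltn; apply/orP; left.
  by rewrite (leq_ltn_trans (rank_leq_col A)) // !card_ffun !card_ord.
case/rowV0Pn => v /sub_kermxP vA /rV0Pn[a va].
exists (\sum_a v 0 a *: 'X_[box_mnm (enum_val a)]).
  apply: contraNneq va => /(congr1 (mcoeff (box_mnm (enum_val a)))).
  rewrite mcoeff0 raddf_sum /= (bigD1 a) //= mcoeffZ mcoeffX eqxx mulr1 big1 ?addr0.
    by move->.
  move=> b ba; rewrite mcoeffZ mcoeffX (inj_eq (@box_mnm_inj _ _)).
  by rewrite (inj_eq enum_val_inj) (negPf ba) mulr0.
rewrite rmorph_sum /=; apply/mpolyP => t; rewrite mcoeff0 raddf_sum /=.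
rewrite (eq_bigr (fun b => v 0 b * (mmap1 y (box_mnm (enum_val b)))@_t)); last first.
  by move=> b _; rewrite /peval mmapZ mmapX mcoeffCM.
have [tL|] := boolP [forall i, t i < L]%N.
  pose e : {ffun 'I_n -> 'I_L} := [ffun i => Ordinal (forallP tL i)].
  have et : box_mnm (enum_val (enum_rank e)) = t.
    by apply/mnmP => i; rewrite enum_rankK mnmE ffunE.
  have /rowP/(_ (enum_rank e)) := vA; rewrite !mxE => vAe.
  by rewrite -[RHS]vAe; apply: eq_bigr => b _; rewrite mxE et.
rewrite negb_forall => /existsP[i]; rewrite -leqNgt => Lt.
apply: big1 => b _; set m := box_mnm _.
rewrite (memN_msupp_eq0 (p := mmap1 y m)) ?mulr0 //.
apply: msize_mdeg_ge; apply: leq_trans (msize_mmap1_leq m yD) _.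
rewrite [X in (_ <= X)%N]mdegE (bigD1 i) //=; apply: leq_trans (leq_addr _ _).
apply: leq_trans Lt; rewrite ltnS leq_mul2r mdegE; apply/orP; right.
apply: (@leq_trans (\sum_(j < q) M)); last by rewrite sum_nat_const card_ord.
by apply: leq_sum => j _; rewrite mnmE ltnW.
Qed.

End AlgebraicDependence.

(** * Prime ideals and heights *)

Section Primes.

Variable R : comNzRingType.
Implicit Types I P W : R -> Prop.

Lemma ideal_gen_ideal (G : R -> Prop) : is_ideal (ideal_gen G).
Proof.
split=> [I []|x y Gx Gy I hI GI|a x Gx I hI GI] //.
  by case: (hI) => _ ID _; apply: ID; [apply: Gx | apply: Gy].
by case: (hI) => _ _ IM; apply: IM; apply: Gx.
Qed.

(** Krull's lemma: an ideal containing [I] and maximal among those disjoint from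
    the multiplicative set [W] is prime. *)
Lemma prime_disjoint_from I W : is_ideal I -> W 1 ->
    (forall x y, W x -> W y -> W (x * y)) -> (forall x, I x -> ~ W x) ->
  exists P, [/\ prime_ideal P, ideal_le I P & forall x, P x -> ~ W x].
Proof.
move=> [I0 ID IM] W1 WM IW.
(* Zorn's lemma is applied to the sets [X] with [X] together with [I] an ideal,
   so that the union of the empty chain is admissible. *)
pose S (X : R -> Prop) : Prop := is_ideal (fun x => X x \/ I x) /\
  forall x, X x \/ I x -> ~ W x.
have [F FS totF|A [[[A0 AD AM] AW] Amax]] := @classical_sets.Zorn_bigcup R S.
  split; last first.
    move=> x [[X FX Xx]|]; last exact: IW.
    by have [_ XW] := FS X FX; apply: XW; left.
  split=> [|x y|a x]; first by right.
  - move=> [[X FX Xx]|Ix] [[Y FY Yy]|Iy].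
    + have [XY|YX] := totF X Y FX FY.
        have [[_ YD _] _] := FS Y FY.
        by have [?|?] := YD x y (or_introl (XY _ Xx)) (or_introl Yy); [left; exists Y|right].
      have [[_ XD _] _] := FS X FX.
      by have [?|?] := XD x y (or_introl Xx) (or_introl (YX _ Yy)); [left; exists X|right].
    + have [[_ XD _] _] := FS X FX.
      by have [?|?] := XD x y (or_introl Xx) (or_intror Iy); [left; exists X|right].
    + have [[_ YD _] _] := FS Y FY.
      by have [?|?] := YD x y (or_intror Ix) (or_introl Yy); [left; exists Y|right].
    + by right; apply: ID.
  - move=> [[X FX Xx]|Ix]; last by right; apply: IM.
    have [[_ _ XM] _] := FS X FX.
    by have [?|?] := XM a x (or_introl Xx); [left; exists X|right].
exists (fun x => A x \/ I x); split=> //; last by move=> x; right.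
split=> [//||x y Pxy]; first by move=> /AW.
pose P z := A z \/ I z.
(* Otherwise the ideal generated by P and z would contradict maximality. *)
have meet z : ~ P z -> exists a p, P p /\ W (p + a * z).
  move=> Pz; apply: boolp.contrapT => nW.
  pose Q w := exists a p, P p /\ w = p + a * z.
  have IQ w : I w -> Q w by move=> Iw; exists 0, w; rewrite mul0r addr0; split; [right|].
  case: (Amax Q); last first.
    split; last first.
      move=> w [|/IQ] [a [p [Pp ->]]] Ww; apply: nW; by exists a, p.
    split=> [|u v|a u]; first by right.
    + move=> Qu Qv.
      have {}Qu : Q u by case: Qu => // /IQ.
      have {}Qv : Q v by case: Qv => // /IQ.
      left; case: Qu Qv => [a [p [Pp ->]]] [b [q [Pq ->]]].
      by exists (a + b), (p + q); split; [apply: AD|ring].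
    + move=> Qu; have {Qu}[b [p [Pp ->]]] : Q u by case: Qu => // /IQ.
      by left; exists (a * b), (a * p); split; [apply: AM|ring].
  split=> [w Aw|QA]; first by exists 0, w; rewrite mul0r addr0; split; [left|].
  by apply: Pz; left; apply: QA; exists 1, 0; rewrite mul1r add0r.
apply: boolp.contrapT => nP.
have [a [p [Pp Wp]]] := meet x (fun Px => nP (or_introl Px)).
have [b [q [Pq Wq]]] := meet y (fun Py => nP (or_intror Py)).
apply: AW (WM _ _ Wp Wq).
have -> : (p + a * x) * (q + b * y) = (q + b * y) * p + (a * x * q + a * b * (x * y)) by ring.
by apply: (AD); [|apply: AD]; apply: AM.
Qed.

End Primes.

Section HeightDependence.

Variable k : fieldType.

Lemma mpoly_split_var0 c (F : {mpoly k[c.+1]}) :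
  exists (F0 : {mpoly k[c]}) F1, F = peval (fun i => 'X_(lift ord0 i)) F0 + 'X_ord0 * F1.
Proof.
elim/mpolyind: F => [|a m p _ _ [F0 [F1 ->]]].
  by exists 0, 0; rewrite rmorph0 mulr0 addr0.
have [m0|m0] := eqVneq (m ord0) 0%N.
  exists (a *: 'X_[[multinom m (lift ord0 i) | i < c]] + F0), F1.
  rewrite rmorphD /= addrA; congr (_ + _ + _).
  rewrite /peval mmapZ mmapX mul_mpolyC mpolyXE_id big_ord_recl m0 expr0 mul1r.
  by congr (_ *: _); apply: eq_bigr => i _; rewrite mnmE.
exists F0, (a *: 'X_[m - U_(ord0)] + F1).
rewrite mulrDr addrCA -scalerAr -mpolyXD addmC submK //.
by rewrite lep1mP.
Qed.

Definition independent_mod n c (P : {mpoly k[n]} -> Prop) (y : 'I_c -> {mpoly k[n]}) :=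
  forall F, F != 0 -> ~ P (peval y F).

(** If a polynomial relation between [f] and [y] lies in [Q], then its part free
    of [f] lies in [P], hence vanishes; the relation is then divisible by [f],
    which can be cancelled modulo the prime [Q]. *)
Lemma independent_mod_extend n c (P Q : {mpoly k[n]} -> Prop) (y : 'I_c -> {mpoly k[n]}) f :
    prime_ideal Q -> prime_ideal P -> ideal_le Q P -> P f -> ~ Q f ->
    independent_mod P y ->
  independent_mod Q (fun j : 'I_c.+1 => if unlift ord0 j is Some i then y i else f).
Proof.
move=> [_ _ Qprime] [[P0 PD PM] _ _] QP Pf Qf yP F.
set y' := fun j => _.
have [N] := ubnP (msize F); elim: N => // N IHN in F *; rewrite ltnS => FN Fn0 QF.
have [F0 [F1 eF]] := mpoly_split_var0 F.
have y'F : peval y' F = peval y F0 + f * peval y' F1.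
  rewrite eF rmorphD rmorphM /= pevalX {2}/y' unlift_none; congr (_ + _).
  rewrite [X in peval y' X]/peval rmorph_mmap; apply: eq_mmap => [a|i] /=.
    exact: pevalC.
  by rewrite pevalX /y' liftK.
have F00 : F0 = 0.
  apply/eqP; apply: contraT => /yP[].
  have -> : peval y F0 = peval y' F + (- peval y' F1) * f by rewrite y'F; ring.
  by apply: PD; [apply: QP | apply: PM].
have F1n0 : F1 != 0 by apply: contraNneq Fn0 => F10; rewrite eF F00 F10 rmorph0 mulr0 addr0.
move: QF; rewrite y'F F00 rmorph0 add0r => /Qprime[//|]; apply: IHN (F1n0).
apply: leq_trans FN; rewrite eF F00 rmorph0 add0r msizeM ?msizeX ?mdeg1 //.
by rewrite -msize_poly_eq0 msizeX.
Qed.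

(** Each step down a chain of primes adds one independent element, and [n]
    variables allow no more than [n] of them. *)
Lemma independent_mod_chain n h c (P : {mpoly k[n]} -> Prop) (y : 'I_c -> {mpoly k[n]}) :
  prime_chain_to P h -> independent_mod P y -> (h + c <= n)%N.
Proof.
move=> [Q [Qprime Qstep QP]] yP.
have [y' y'Q] : exists y' : 'I_(h + c) -> {mpoly k[n]}, independent_mod (Q 0%N) y'.
  suff: forall i, (i <= h)%N ->
      exists y' : 'I_(i + c) -> {mpoly k[n]}, independent_mod (Q (h - i)%N) y'.
    by move/(_ h (leqnn h)); rewrite subnn.
  elim=> [_|i IHi ih].
    by rewrite subn0; exists y => F F0 /QP; apply: yP.
  have [y' y'Q] := IHi (ltnW ih).
  have ehi : (h - i = (h - i.+1).+1)%N by rewrite subnSK.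
  have lthi : (h - i.+1 < h)%N by rewrite -ehi leq_subr.
  have [le nle] := Qstep _ lthi; rewrite ehi in y'Q.
  have [f [Qf nQf]] : exists f, Q (h - i.+1).+1 f /\ ~ Q (h - i.+1)%N f.
    apply: boolp.contrapT => nf; apply: nle => f Qf; apply: boolp.contrapT => nQf.
    by apply: nf; exists f.
  exists (fun j : 'I_(i + c).+1 => if unlift ord0 j is Some i then y' i else f).
  exact: independent_mod_extend (Qprime _ (ltnW lthi)) (Qprime _ lthi) le Qf nQf y'Q.
rewrite leqNgt; apply/negP => /(algebraic_dependence y')[F F0 y'F].
by apply: (y'Q F F0); rewrite y'F; case: (Qprime 0%N (leq0n h)) => [[]].
Qed.

(** The values [F(y)], for [F] nonzero, form a multiplicative set; a prime
    containing [I] and disjoint from it would leave [y] independent modulo a prime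
    of height at least [h]. *)
Lemma height_dependence n h c (I : {mpoly k[n]} -> Prop) (y : 'I_c -> {mpoly k[n]}) :
    is_ideal I -> (forall P, prime_ideal P -> ideal_le I P -> prime_chain_to P h) ->
    (n < h + c)%N ->
  exists2 F, F != 0 & I (peval y F).
Proof.
move=> hI htI nhc; apply: boolp.contrapT => nF.
have [||u v [F F0 ->] [G G0 ->]|u Iu [F F0 Fu]|P [Pprime IP PW]] :=
  @prime_disjoint_from _ I (fun z => exists2 F, F != 0 & z = peval y F).
- exact: hI.
- by exists 1; rewrite ?oner_eq0 ?rmorph1.
- by exists (F * G); rewrite ?rmorphM ?mulf_neq0.
- by apply: nF; exists F; rewrite -?Fu.
have yP : independent_mod P y by move=> F F0 PF; apply: PW PF _; exists F.
by have := independent_mod_chain (htI P Pprime IP) yP; rewrite leqNgt nhc.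
Qed.

End HeightDependence.

(** * Regular sequences *)

Section RegularSequences.

Fixpoint span (R : comNzRingType) (s : seq R) (x : R) : Prop :=
  if s is a :: s' then exists q, span s' (x - q * a) else x = 0.

(** Weakly regular sequences, listed with the last element first so that extending
    one is consing. *)
Fixpoint regular (R : comNzRingType) (s : seq R) : Prop :=
  if s is a :: s' then regular s' /\ (forall u, span s' (a * u) -> span s' u) else True.

Lemma span_ideal (R : comNzRingType) (s : seq R) : is_ideal (span s).
Proof.
elim: s => [|a s [s0 sD sM]] /=.
  by split=> [|x y -> ->|b x ->] //; rewrite ?addr0 ?mulr0.
split=> [|x y [p px] [q qy]|b x [p px]].
- by exists 0; rewrite mul0r subr0.
- exists (p + q); have -> : x + y - (p + q) * a = (x - p * a) + (y - q * a) by ring.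
  exact: sD.
- exists (b * p); have -> : b * x - b * p * a = b * (x - p * a) by ring.
  exact: sM.
Qed.

Lemma span_map (R R' : comNzRingType) (f : {rmorphism R -> R'}) s x :
  span s x -> span (map f s) (f x).
Proof.
elim: s x => [x ->|a s IHs x [q /IHs]] /=; first exact: rmorph0.
by rewrite rmorphB rmorphM => qx; exists (f q).
Qed.

Lemma regular_map_iso (R R' : comNzRingType) (f : {rmorphism R -> R'})
    (g : {rmorphism R' -> R}) s :
  cancel f g -> cancel g f -> regular s -> regular (map f s).
Proof.
move=> fK gK; elim: s => //= a s IHs [/IHs reg_s reg_a]; split=> // u.
move=> /(span_map g); rewrite rmorphM fK mapK // => /reg_a /(span_map f).
by rewrite gK.
Qed.

Lemma span_polyC (R : comNzRingType) (s : seq R) (p : {poly R}) :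
  span (map polyC s) p <-> forall i, span s p`_i.
Proof.
elim: s p => [|a s IHs] p /=.
  by split=> [-> i|p0]; [rewrite coef0 | apply/polyP => i; rewrite p0 coef0].
split=> [[q /IHs sq] i|sp]; first by exists q`_i; have := sq i; rewrite coefB coefMC.
have [q qP] := fin_all_exists (fun i : 'I_(size p) => sp i).
pose c j := if insub j is Some i then q i else 0.
exists (\poly_(j < size p) c j); apply/IHs => j; rewrite coefB coefMC coef_poly.
have [jp|jp] := ltnP j (size p); first by rewrite /c insubT; apply: qP (Ordinal jp).
by rewrite nth_default // mul0r subr0; case: (span_ideal s).
Qed.

(** Such an [a] is a nonzerodivisor modulo the extension of [J], as is seen on
    leading coefficients. *)
Lemma coef_ideal_cancel (R : comUnitRingType) (J : R -> Prop) (a u : {poly R}) :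
    is_ideal J -> lead_coef a \is a GRing.unit ->
  (forall i, J (a * u)`_i) -> forall i, J u`_i.
Proof.
move=> [J0 JD JM] ua.
have [N] := ubnP (size u); elim: N => // N IHN in u *; rewrite ltnS => uN Jau.
have [->|u0] := eqVneq u 0; first by move=> i; rewrite coef0.
pose v := u - lead_coef u *: 'X^((size u).-1).
have Jl : J (lead_coef u).
  have -> : lead_coef u = (lead_coef a)^-1 * (a * u)`_(size a + size u).-2.
    by rewrite -mul_lead_coef mulKr.
  exact: (JM).
have Jlc i : J (lead_coef u *: 'X^((size u).-1))`_i by rewrite coefZ mulrC; apply: (JM).
have Jv : forall i, J v`_i.
  apply: IHN => [|i].
    apply: leq_trans uN; rewrite -(prednK (n := size u)) ?size_poly_gt0 // ltnS.
    apply/leq_sizeP => j; rewrite leq_eqVlt => /predU1P[<-|uj].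
      by rewrite coefB coefZ coefXn eqxx mulr1 subrr.
    rewrite coefB coefZ coefXn gtn_eqF // mulr0 subr0 nth_default //.
    by rewrite -(prednK (n := size u)) ?size_poly_gt0.
  rewrite mulrBr coefB -mulN1r; apply: (JD) => //; apply: (JM).
  by rewrite -scalerAr coefZ mulrC; apply: (JM).
move=> i; have -> : u`_i = v`_i + (lead_coef u *: 'X^((size u).-1))`_i.
  by rewrite -coefD subrK.
exact: (JD).
Qed.

(** Coefficientwise, a regular sequence of [R] stays regular in [R[X]]; modulo it
    [a] still has an invertible leading coefficient. *)
Lemma regular_cons_polyC (R : comUnitRingType) (a : {poly R}) (s : seq R) :
  lead_coef a \is a GRing.unit -> regular s -> regular (a :: map polyC s).
Proof.
move=> ua reg_s; split=> [|u /span_polyC sau]; last first.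
  by apply/span_polyC; apply: coef_ideal_cancel sau; [apply: span_ideal|].
elim: s reg_s => //= b s IHs [/IHs reg_s reg_b]; split=> // u /span_polyC sbu.
by apply/span_polyC => i; apply: reg_b; have := sbu i; rewrite coefCM.
Qed.

End RegularSequences.

(** * Noether normalization and the height of an ideal *)

Section Nagata.

Variable k : fieldType.

Lemma peval_id n (p : {mpoly k[n]}) : peval (fun i => 'X_i) p = p.
Proof.
rewrite [RHS]mpolyE; apply: eq_bigr => m _.
by rewrite mmap1_id mul_mpolyC.
Qed.

(** The degree that the monomial [m] acquires under the substitution [nagata]. *)
Definition weight N q (m : 'I_q -> nat) := (\sum_j m j * N ^ j)%N.

Lemma weight_inj N q (m m' : 'I_q -> nat) :
    (forall j, m j < N)%N -> (forall j, m' j < N)%N ->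
  weight N m = weight N m' -> m =1 m'.
Proof.
rewrite /weight; elim: q m m' => [|q IHq] m m' mN m'N; first by move=> _ [].
have shift (u : 'I_q.+1 -> nat) : (\sum_j u j * N ^ j =
    u ord0 + (\sum_(j < q) u (lift ord0 j) * N ^ j) * N)%N.
  rewrite big_ord_recl expn0 muln1; congr (_ + _)%N.
  by rewrite big_distrl; apply: eq_bigr => j _ /=; rewrite -mulnA -expnSr.
rewrite !shift => e.
have e0 : m ord0 = m' ord0.
  by have := congr1 (modn^~ N) e; rewrite ![(_ + _ * N)%N]addnC !modnMDl !modn_small.
move: e; rewrite e0 => /addnI/eqP; rewrite eqn_pmul2r => [/eqP e j|]; last first.
  exact: leq_ltn_trans (mN ord0).
case: (unliftP ord0 j) => [i ->|->] //.
by apply: (IHq (fun i => m (lift ord0 i)) (fun i => m' (lift ord0 i))) => // ?.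
Qed.

Section Change.

Variables (n N : nat).
Local Notation R := {mpoly k[n.+1]}.
Local Notation S := {mpoly k[n]}.

(** Nagata's substitution, which works over finite fields as well, where a
    linear change of coordinates may not suffice. Its values are written as
    polynomials in the first variable. *)
Definition nagata_var (j : 'I_n.+1) : {poly S} :=
  'X^(N ^ j) + (if unlift ord0 j is Some i then 'X_i else 0)%:P.

Definition nagata : R -> {poly S} := mmap (polyC \o @mpolyC n k) nagata_var.
HB.instance Definition _ := GRing.RMorphism.copy nagata (mmap (polyC \o @mpolyC n k) nagata_var).

Definition nagata_base : S -> R :=
  peval (fun i => 'X_(lift ord0 i) - 'X_ord0 ^+ (N ^ lift ord0 i)).
HB.instance Definition _ := GRing.RMorphism.copy nagata_base
  (peval (fun i => 'X_(lift ord0 i) - 'X_ord0 ^+ (N ^ lift ord0 i))).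

Lemma nagata_baseX i : nagata_base 'X_i = 'X_(lift ord0 i) - 'X_ord0 ^+ (N ^ lift ord0 i).
Proof. exact: pevalX. Qed.

Definition nagata_inv : {poly S} -> R :=
  horner_morph (fun p => mulrC 'X_ord0 (nagata_base p)).
HB.instance Definition _ := GRing.RMorphism.copy nagata_inv
  (horner_morph (fun p => mulrC 'X_ord0 (nagata_base p))).

Lemma nagata_invC c : nagata_inv (c%:MP)%:P = c%:MP.
Proof. by rewrite /nagata_inv horner_morphC /=; apply: pevalC. Qed.

Lemma nagataK : cancel nagata nagata_inv.
Proof.
move=> p; rewrite /nagata rmorph_mmap -[RHS]peval_id; apply: eq_mmap => [c|j] /=.
  exact: nagata_invC.
rewrite /nagata_var rmorphD rmorphXn /= /nagata_inv horner_morphX horner_morphC.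
case: (unliftP ord0 j) => [i ->|->]; last by rewrite rmorph0 addr0 expn0 expr1.
by rewrite [X in _ + X]nagata_baseX addrC subrK.
Qed.

Lemma nagata_invK : cancel nagata_inv nagata.
Proof.
have nX j : nagata 'X_j = nagata_var j by rewrite /nagata mmapX mmap1U.
have n0 : nagata 'X_ord0 = 'X.
  by rewrite nX /nagata_var unlift_none polyC0 addr0 expn0 expr1.
elim/poly_ind => [|p c IHp]; first by rewrite !rmorph0.
rewrite rmorphD rmorphM /= {2 3}/nagata_inv horner_morphX horner_morphC.
rewrite rmorphD rmorphM /= IHp n0; congr (_ + _).
rewrite -[in RHS](peval_id c) /nagata_base /peval !rmorph_mmap.
apply: eq_mmap => [b|i] /=; first by rewrite /nagata mmapC.
by rewrite rmorphB rmorphXn /= n0 nX /nagata_var liftK addrC addKr.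
Qed.

(** The substitution turns the monomials of [a] into monic polynomials of
    pairwise distinct degrees, namely their base-[N] weights. *)
Lemma nagata_lead_coef (a : R) :
    a != 0 -> (msize a <= N)%N -> lead_coef (nagata a) \is a GRing.unit.
Proof.
move=> a0 aN.
have N0 : (0 < N)%N by apply: leq_trans aN; rewrite lt0n msize_poly_eq0.
have varP j : nagata_var j \is monic /\ size (nagata_var j) = (N ^ j).+1.
  have lt : (size (if unlift ord0 j is Some i then 'X_i else 0 : S)%:P
             < size ('X^(N ^ j) : {poly S}))%N.
    by rewrite size_polyXn ltnS (leq_trans (size_polyC_leq1 _)) // expn_gt0 N0.
  by rewrite monicE lead_coefDl // size_polyDl // lead_coefXn size_polyXn.
have mulP (p q : {poly S}) s t : p \is monic /\ size p = s.+1 -> q \is monic /\ size q = t.+1 ->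
    p * q \is monic /\ size (p * q) = (s + t).+1.
  move=> [pm ps] [qm qs]; rewrite monicMl // qm size_monicM ?monic_neq0 // ps qs.
  by rewrite addSn addnS.
have monP m : mmap1 nagata_var m \is monic /\
    size (mmap1 nagata_var m) = (weight N m).+1.
  rewrite /mmap1 /weight; elim/big_ind2: _ => [|p s q t|j _]; first by rewrite monic1 size_poly1.
    exact: mulP.
  elim: (m j) => [|e IHe]; first by rewrite expr0 monic1 size_poly1.
  by rewrite exprS mulSn; apply: mulP.
have suppN (m : 'X_{1..n.+1}) : m \in msupp a -> forall j, (m j < N)%N.
  move=> ma j; apply: leq_trans aN; apply: leq_ltn_trans (msize_mdeg_lt ma).
  by rewrite mdegE (bigD1 j) //= leq_addr.
have [m0 m0a m0max] : exists2 m0, m0 \in msupp a &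
    forall m, m \in msupp a -> (weight N m <= weight N m0)%N.
  have ne : msupp a != [::] by rewrite msupp_eq0.
  have exw : exists w, has (fun m : 'X_{1..n.+1} => weight N m == w) (msupp a).
    case: (msupp a) ne => // m s _; exists (weight N m) => /=; by rewrite eqxx.
  have ubw w : has (fun m : 'X_{1..n.+1} => weight N m == w) (msupp a) ->
      (w <= \sum_(m <- msupp a) weight N m)%N.
    by case/hasP => m ma /eqP <-; rewrite (big_rem m) //= leq_addr.
  case: (ex_maxnP exw ubw) => w /hasP[m ma /eqP mw] wmax.
  by exists m => // m' m'a; rewrite mw; apply: wmax; apply/hasP; exists m'.
have coefw : (nagata a)`_(weight N m0) = (a@_m0)%:MP.
  rewrite /nagata /mmap coef_sum (big_rem m0) //= coefCM.
  have [/monicP lc sz] := monP m0; rewrite lead_coefE sz /= in lc.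
  rewrite lc mulr1 big_seq big1 ?addr0 // => m; rewrite mem_rem_uniq ?msupp_uniq //.
  case/andP=> mm0 ma; rewrite coefCM nth_default ?mulr0 //.
  have [_ ->] := monP m; rewrite ltn_neqAle m0max // andbT.
  apply: contraNneq mm0 => /weight_inj e; apply/eqP/mnmP => j.
  by apply: e; apply: suppN.
have szw : (size (nagata a) <= (weight N m0).+1)%N.
  apply/leq_sizeP => i wi; rewrite /nagata /mmap coef_sum big_seq big1 // => m ma.
  rewrite coefCM nth_default ?mulr0 //; have [_ ->] := monP m.
  by apply: leq_ltn_trans wi; apply: m0max.
have c0 : a@_m0 != 0 by rewrite -mcoeff_msupp.
rewrite lead_coefE; have -> : (size (nagata a)).-1 = weight N m0.
  apply/eqP; rewrite eqn_leq; apply/andP; split.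
    by rewrite -subn1 leq_subLR add1n.
  rewrite -ltnS prednK; last by rewrite size_poly_gt0; apply: contraNneq c0 => na0;
    move: coefw; rewrite na0 coef0 => /esym/eqP; rewrite mpolyC_eq0.
  rewrite ltnNge; apply: contra c0 => /leq_sizeP/(_ _ (leqnn _)).
  by rewrite coefw => /eqP; rewrite mpolyC_eq0.
rewrite coefw; apply: rmorph_unit; by rewrite unitfE.
Qed.

End Change.

Lemma noether_normalization n (a : {mpoly k[n.+1]}) : a != 0 ->
  exists (f : {rmorphism {mpoly k[n.+1]} -> {poly {mpoly k[n]}}})
         (g : {rmorphism {poly {mpoly k[n]}} -> {mpoly k[n.+1]}}),
  [/\ cancel f g, cancel g f, forall b, g (b%:MP)%:P = b%:MP
    & lead_coef (f a) \is a GRing.unit].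
Proof.
move=> a0; exists (@nagata n (msize a)), (@nagata_inv n (msize a)); split.
- exact: nagataK.
- exact: nagata_invK.
- exact: nagata_invC.
- exact: nagata_lead_coef.
Qed.

(** A nonzero [a] in [I] becomes monic in one variable after a change of
    coordinates. The dependence hypothesis, being about arbitrary elements, holds
    for the contraction [J] of [I] to the other variables with the same number of
    elements, so the length of the regular sequence drops with the number of
    variables; a regular sequence in [J] is then extended by [a]. *)
Lemma regular_of_dependence h c n (I : {mpoly k[n]} -> Prop) :
    n = (h + c)%N -> is_ideal I ->
    (forall y : 'I_c.+1 -> {mpoly k[n]}, exists2 F, F != 0 & I (peval y F)) ->
  exists s, [/\ size s = h, {in s, forall x, I x} & regular s].
Proof.
elim: h n I => [|h IHh] n I; first by exists [::].
rewrite addSn => en; move: I; rewrite en => {n en} I hI dep.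
have le_c : (c.+1 <= (h + c).+1)%N by rewrite ltnS leq_addl.
(* The variables themselves are independent, so a relation between c + 1 of them
   is a nonzero element of I. *)
have [a Ia a0] : exists2 a, I a & a != 0.
  have [F F0 IF] := dep (fun i => 'X_(widen_ord le_c i)); eexists; first exact: IF.
  pose z (j : 'I_(h + c).+1) : {mpoly k[c.+1]} := if insub (j : nat) is Some i then 'X_i else 0.
  apply: contraNneq F0 => /(congr1 (peval z)).
  rewrite rmorph0 [X in peval z X]/peval rmorph_mmap => <-; apply/eqP; rewrite -[LHS]peval_id.
  apply: eq_mmap => [b|i] /=; first by rewrite pevalC.
  by rewrite pevalX /z insubT //= => ?; congr 'X_(_); apply: val_inj.
have [I0 ID IM] := hI; have [f [g [fK gK gC ua]]] := noether_normalization a0.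
pose J s := I (g s%:P).
have [||s [s_h sJ s_reg]] := IHh _ J erefl.
- rewrite /J; split=> [|x y Jx Jy|x y Jy].
  + by rewrite polyC0 rmorph0.
  + by rewrite polyCD rmorphD; apply: ID Jx Jy.
  + by rewrite polyCM rmorphM; apply: IM Jy.
- move=> y; have [F F0 IF] := dep (fun i => g (y i)%:P); exists F => //.
  rewrite /J; have <- : peval (fun i => g (y i)%:P) F = g (peval y F)%:P by
    rewrite [in RHS]/peval !rmorph_mmap; apply: eq_mmap => b //=; rewrite gC.
  exact: IF.
exists (a :: [seq g x%:P | x <- s]); split.
- by rewrite /= size_map s_h.
- by move=> x; rewrite inE => /predU1P[->//|/mapP[t /sJ Jt ->]].
have := regular_cons_polyC ua s_reg.
move/(regular_map_iso gK fK).
by rewrite /= fK -map_comp.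
Qed.

(** Polynomial rings over a field are Cohen-Macaulay: the grade of an ideal is at
    least its height. *)
Lemma regular_of_height h n (I : {mpoly k[n]} -> Prop) :
    (h <= n)%N -> is_ideal I ->
    (forall P, prime_ideal P -> ideal_le I P -> prime_chain_to P h) ->
  exists s, [/\ size s = h, {in s, forall x, I x} & regular s].
Proof.
move=> hn hI htI; apply: (@regular_of_dependence h (n - h)) => //.
  by rewrite subnKC.
by move=> y; apply: (height_dependence (h := h)); rewrite // addnS subnKC.
Qed.

End Nagata.

(** * Exactness from regular sequences *)

Section Exactness.

Variable R : idomainType.

Lemma col_choice q (P : 'I_q -> R -> Prop) :
  (forall i, exists w, P i w) -> exists w : 'cV[R]_q, forall i, P i (w i 0).
Proof.
by case/fin_all_exists => f fP; exists (\col_i f i) => i; rewrite mxE.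
Qed.

Lemma scale_col_inj q (a : R) (v w : 'cV[R]_q) : a != 0 -> a *: v = a *: w -> v = w.
Proof.
move=> a0 /colP vw; apply/colP => i; apply: (mulfI a0).
by have := vw i; rewrite !mxE.
Qed.

Lemma regular_head_neq0 (a : R) : regular [:: a] -> a != 0.
Proof.
case=> _ /= a_reg; apply/eqP => a0.
by have /eqP := a_reg 1 (etrans (mulr1 a) a0); rewrite oner_eq0.
Qed.

Lemma regular2_col q (a b : R) (y z : 'cV[R]_q) :
  regular [:: b; a] -> b *: y = a *: z -> exists w, y = a *: w.
Proof.
case=> _ reg_b /colP byaz.
have /col_choice[w wP] : forall i, exists w, y i 0 = w * a.
  move=> i; have [|w /eqP] := reg_b (y i 0); last first.
    by rewrite subr_eq0 => /eqP; exists w.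
  by exists (z i 0); have := byaz i; rewrite !mxE => ->; rewrite mulrC subrr.
by exists w; apply/colP => i; rewrite mxE wP mulrC.
Qed.

(** The grade-two step of the acyclicity lemma. *)
Lemma regular2_image p q (N : 'M[R]_(p, q)) (a b : R) (v : 'cV[R]_p) y z :
    injective_mx N -> regular [:: b; a] ->
    a *: v = N *m y -> b *: v = N *m z ->
  exists w, v = N *m w.
Proof.
move=> injN reg av bv; have [/regular_head_neq0 a0 _] := reg.
have byaz : b *: y = a *: z.
  apply/subr0_eq/injN; rewrite mulmxBr -!scalemxAr -av -bv !scalerA.
  by rewrite [b * a]mulrC subrr.
have [w yw] := regular2_col reg byaz; exists w.
by apply: (scale_col_inj a0); rewrite av yw scalemxAr.
Qed.

(** The grade-three step: [u1], [u2] and [u3] measure how [y], [z] and [t] fail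
    to be compatible, and the relation between them allows [y] and [z] to be
    corrected so that [b *: y = a *: z]. *)
Lemma regular3_image p1 p2 p3 (M2 : 'M[R]_(p1, p2)) (M3 : 'M[R]_(p2, p3))
    (a b c : R) (x : 'cV[R]_p1) y z t :
    injective_mx M3 -> exact_at M2 M3 -> regular [:: c; b; a] ->
    a *: x = M2 *m y -> b *: x = M2 *m z -> c *: x = M2 *m t ->
  exists w, x = M2 *m w.
Proof.
move=> inj3 ex2 reg ax bx cx.
have ker2 v : M2 *m v = 0 <-> exists u, v = M3 *m u := ex2 v.
have [reg_ba reg_c] := reg; have [/regular_head_neq0 a0 _] := reg_ba.
have syz s s' v v' : s *: x = M2 *m v -> s' *: x = M2 *m v' ->
    exists u, s' *: v - s *: v' = M3 *m u.
  move=> sx s'x; apply/ker2; rewrite mulmxBr -!scalemxAr -sx -s'x !scalerA.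
  by rewrite [s' * s]mulrC subrr.
have [u1 e1] := syz _ _ _ _ ax bx.
have [u2 e2] := syz _ _ _ _ ax cx.
have [u3 e3] := syz _ _ _ _ bx cx.
have cu1 : c *: u1 = b *: u2 - a *: u3.
  apply/subr0_eq/inj3; rewrite !mulmxBr -!scalemxAr -e1 -e2 -e3.
  by apply/colP => i; rewrite !mxE; ring.
have /col_choice[s sP] : forall i, exists s, exists s', u1 i 0 = b * s + a * s'.
  move=> i; have [|s [s' /eqP]] := reg_c (u1 i 0); last first.
    by rewrite !subr_eq0 subr_eq => /eqP e; exists s, s'; rewrite e; ring.
  exists (u2 i 0), (- u3 i 0); have /colP/(_ i) := cu1; rewrite !mxE => ->.
  by ring.
have [s' s'P] := fin_all_exists sP.
pose s1 : 'cV[R]_p3 := \col_i s' i.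
have eu1 : u1 = b *: s + a *: s1 by apply/colP => i; rewrite !mxE s'P.
have M30 (v : 'cV[R]_p3) : M2 *m (M3 *m v) = 0 by apply/ker2; exists v.
have [|w yw] := @regular2_col _ a b (y - M3 *m s) (z + M3 *m s1) reg_ba.
  apply/subr0_eq; rewrite scalerBr scalerDr !scalemxAr.
  rewrite opprD addrACA -opprD e1 eu1 mulmxDr.
  by rewrite subrr.
exists w; apply: (scale_col_inj a0); rewrite ax scalemxAr -yw mulmxBr M30 subr0.
by [].
Qed.

End Exactness.

(** * Maximal minors of an (m+1) x m matrix *)

Section HilbertBurch.

Variable R : idomainType.

(** Selecting rows and columns in two steps multiplies the minor by the
    determinants of the selection matrices, which absorbs all questions of order
    and sign. *)
Lemma det_factor_mxsub m p q (A : 'M[R]_(p, q))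
    (f f' : 'I_m -> 'I_p) (g g' : 'I_m -> 'I_q) s t :
    (forall i, f i = f' (s i)) -> (forall j, g j = g' (t j)) ->
  exists c, \det (mxsub f g A) = c * \det (mxsub f' g' A).
Proof.
move=> fs gt; exists (\det (rowsub s 1%:M : 'M[R]_m) * \det (colsub t 1%:M : 'M[R]_m)).
rewrite mulrAC -!det_mulmx mul_rowsub_mx mul1mx mulmx_colsub mulmx1.
by congr (\det _); apply/matrixP => i j; rewrite !mxE fs gt.
Qed.

Lemma missing_index p q (f : 'I_p -> 'I_q) : (p < q)%N -> exists i, forall l, f l != i.
Proof.
move=> pq; have : ~~ [forall i, i \in codom f].
  apply: contraL pq => /forallP fS; rewrite -leqNgt -(card_ord q) -(card_ord p).
  apply: leq_trans (leq_image_card f _).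
  by apply: subset_leq_card; apply/subsetP => i _; apply: fS.
rewrite negb_forall => /existsP[i fi]; exists i => l.
by apply: contraNneq fi => <-; apply: codom_f.
Qed.

Lemma missing_index_lift p q (f : 'I_p -> 'I_q.+1) : (p <= q)%N ->
  exists (i : 'I_q.+1) (s : 'I_p -> 'I_q), forall l, f l = lift i (s l).
Proof.
move=> pq; have [|i fi] := @missing_index _ _ f; first by rewrite ltnS.
have [s sP] : exists s : 'I_p -> 'I_q, forall l, f l = lift i (s l).
  apply: (fin_all_exists (P := fun l (j : 'I_q) => f l = lift i j)) => l.
  case: (unliftP i (f l)) => [j fl|fl]; first by exists j.
  by have := fi l; rewrite fl eqxx.
by exists i, s.
Qed.

Lemma mulmx_row'_col' p q (A : 'M[R]_(p, q.+1)) (v : 'cV[R]_q.+1) i l :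
  (A *m v) l 0 = A l i * v i 0 + (col' i A *m row' i v) l 0.
Proof.
by rewrite !mxE (bigD1_ord i) //=; congr (_ + _); apply: eq_bigr => j _; rewrite !mxE.
Qed.

Lemma det_scale_adj m (N : 'M[R]_m) (u : 'cV[R]_m) : \det N *: u = \adj N *m (N *m u).
Proof. by rewrite mulmxA mul_adj_mx mul_scalar_mx. Qed.

Lemma minor_injective p q (A : 'M[R]_(p, q)) (f : 'I_q -> 'I_p) (g : 'I_q -> 'I_q) :
  \det (mxsub f g A) != 0 -> injective_mx A.
Proof.
have [c ->] := @det_factor_mxsub q _ _ A f f g id id g (fun=> erefl) (fun=> erefl).
rewrite mulf_eq0 negb_or => /andP[_ N0] u Au; apply: (scale_col_inj N0).
rewrite det_scale_adj scaler0 mul_rowsub_mx Au; apply/colP => i.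
by rewrite mxE big1 ?mxE // => j _; rewrite !mxE mulr0.
Qed.

Lemma minors_ideal_neq0 p q t (A : 'M[R]_(p, q)) x : minors_ideal t A x -> x != 0 ->
  exists f g, \det (mxsub f g A : 'M_t) != 0.
Proof.
move=> Ix x0; suff : x = 0 \/ exists f g, \det (mxsub f g A : 'M_t) != 0.
  by case=> // x00; rewrite x00 eqxx in x0.
apply: (Ix (fun x => x = 0 \/ _)) => [|{x0 Ix}x [f [g [_ _ ->]]]].
  split=> [|u v [->|?] [->|?]|u v [->|?]]; try by right.
  - by left.
  - by left; rewrite addr0.
  - by left; rewrite mulr0.
have [->|] := eqVneq (\det (mxsub f g A)) 0; first by left.
by right; exists f, g.
Qed.

Lemma minors_ideal_injective p q (A : 'M[R]_(p, q)) x :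
  minors_ideal q A x -> x != 0 -> injective_mx A.
Proof. by move=> Ix /(minors_ideal_neq0 Ix)[f [g /minor_injective]]. Qed.

Lemma scale_image_ideal p q (A : 'M[R]_(p, q)) (v : 'cV[R]_p) :
  is_ideal (fun x => exists u, x *: v = A *m u).
Proof.
split=> [|s t [a sa] [b tb]|s t [b tb]].
- by exists 0; rewrite scale0r mulmx0.
- by exists (a + b); rewrite scalerDl mulmxDr sa tb.
- by exists (s *: b); rewrite -scalerA tb scalemxAr.
Qed.

Variables (m : nat) (M : 'M[R]_(m.+1, m)).

Definition maximal_minors : 'rV[R]_m.+1 := \row_i ((-1) ^+ i * \det (row' i M)).

Local Notation p := maximal_minors.

Lemma maximal_minors_mulmx : p *m M = 0.
Proof.
apply/rowP => l; rewrite !mxE.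
pose C : 'M[R]_m.+1 := \matrix_(i, j) oapp (M i) (M i l) (unlift ord0 j).
have -> : \sum_j p 0 j * M j l = \det C.
  rewrite (expand_det_col C ord0); apply: eq_bigr => i _.
  rewrite !mxE unlift_none /= mulrC /cofactor addn0; congr (_ * (_ * \det _)).
  by apply/matrixP => a b; rewrite !mxE liftK.
rewrite -det_tr; apply: (@determinant_alternate _ _ _ ord0 (lift ord0 l)) => //.
by move=> j; rewrite !mxE unlift_none liftK.
Qed.

(** Solve for all rows but the [i]th by Cramer's rule: the discrepancy in row [i]
    is annihilated by the [i]th minor, hence vanishes when that minor does not. *)
Lemma maximal_minor_kernel i (v : 'cV[R]_m.+1) :
  p *m v = 0 -> exists u, p 0 i *: v = M *m u.
Proof.
move=> pv; have [pi0|pi0] := eqVneq (p 0 i) 0.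
  by exists 0; rewrite pi0 scale0r mulmx0.
pose N := row' i M; pose u := \adj N *m row' i v.
have Nu l : (M *m u) (lift i l) 0 = \det N * v (lift i l) 0.
  have /colP/(_ l) : N *m u = \det N *: row' i v by rewrite mulmxA mul_mx_adj mul_scalar_mx.
  by rewrite !mxE => <-; apply: eq_bigr => j _; rewrite !mxE.
pose w := M *m u - \det N *: v.
have pw : p *m w = 0.
  by rewrite mulmxBr mulmxA maximal_minors_mulmx mul0mx -scalemxAr pv scaler0 subr0.
have w0 : w = 0.
  have wl l : w (lift i l) 0 = 0 by rewrite /w mxE Nu !mxE subrr.
  apply/colP => l; case: (unliftP i l) => [j ->|->]; first by rewrite wl mxE.
  have := congr1 (fun z : 'M_1 => z 0 0) pw.
  rewrite mxE (bigD1_ord i) //= big1 => [|j _]; last by rewrite wl mulr0.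
  by rewrite addr0 [RHS]mxE => /eqP; rewrite mulf_eq0 (negPf pi0) => /eqP ->; rewrite mxE.
exists ((-1) ^+ i *: u); rewrite -scalemxAr.
have -> : M *m u = \det N *: v by apply/subr0_eq.
by rewrite scalerA !mxE.
Qed.

Lemma minors_ideal_max x : minors_ideal m M x ->
  forall v : 'cV[R]_m.+1, p *m v = 0 -> exists u, x *: v = M *m u.
Proof.
move=> Ix v pv; apply: (Ix (fun x => exists u, x *: v = M *m u)).
  exact: scale_image_ideal.
move=> {Ix}x [f [g [_ _ ->]]].
have [i [s fs]] := missing_index_lift f (leqnn m).
have [c ->] := @det_factor_mxsub m _ _ M f (lift i) g id s g fs (fun=> erefl).
have [u pu] := maximal_minor_kernel i pv.
exists (c *: ((-1) ^+ i *: u)); rewrite -!scalemxAr -pu !scalerA; congr (_ *: _).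
rewrite mxE -mulrA; congr (_ * _); rewrite mulrA -expr2 sqrr_sign mul1r.
by congr (\det _); apply/matrixP => a b; rewrite !mxE.
Qed.

(** The Hilbert-Burch theorem: [a] and [b], being combinations of maximal minors,
    annihilate the homology, which a regular sequence of length two cannot do unless
    the homology is zero. *)
Lemma hilbert_burch a b :
    minors_ideal m M a -> minors_ideal m M b -> regular [:: b; a] ->
  exact_at p M.
Proof.
move=> Ia Ib reg v; split=> [pv|[u ->]]; last first.
  by rewrite mulmxA maximal_minors_mulmx mul0mx.
have [y ay] := minors_ideal_max Ia pv; have [z bz] := minors_ideal_max Ib pv.
apply: regular2_image (reg) ay bz; apply: minors_ideal_injective Ia _.
by apply: regular_head_neq0; case: reg.
Qed.

End HilbertBurch.

(** * The skew-symmetric matrix of maximal minors of an r x (r+2) matrix *)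

Section BuchsbaumRim.

Variables (n : nat) (k : fieldType) (r : nat).
Local Notation R := {mpoly k[n]}.
Variable B : 'M[R]_(r, r.+2).
Local Notation K := (Kmx B).

Lemma Delta_lift i j : Delta B i (lift i j) = \det (col' j (col' i B)).
Proof. by rewrite /Delta liftK. Qed.

Lemma Delta_sym i j : Delta B i j = Delta B j i.
Proof.
case: (unliftP i j) => [j' ->|->] //.
case: (unliftP (lift i j') i) => [i' ei|ei]; last by have := neq_lift i j'; rewrite -ei eqxx.
have -> : Delta B (lift i j') i = \det (col' i' (col' (lift i j') B)).
  by rewrite {2}ei Delta_lift.
rewrite Delta_lift; congr (\det _).
apply/matrixP => a c; rewrite !mxE; congr (B a _); apply: val_inj => /=.
have -> : i' = unbump j' i :> nat.
  rewrite -(bumpK (lift i j') i') -[bump _ _]/(nat_of_ord (lift (lift i j') i')) -ei.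
  rewrite /unbump /= /bump.
  by case: (leqP i j') => ij; [rewrite ltnNge (leq_trans ij (leq_addl _ _))|rewrite add0n ij].
exact: bumpC.
Qed.

Lemma sigma_lift (i : 'I_r.+2) (j : 'I_r.+1) :
  sigma n k i (lift i j) = - (-1) ^+ i * (-1) ^+ j.
Proof.
rewrite /sigma /= /bump; case: (leqP i j) => ij.
  rewrite -[(true + j)%N]/(j.+1) ltnS ij subSn // exprS mulN1r -signr_odd oddB //.
  by rewrite signr_addb !signr_odd mulNr mulrC.
rewrite -[(false + j)%N]/(nat_of_ord j) ltnNge (ltnW ij) /=.
by rewrite -signr_odd oddB 1?ltnW // signr_addb !signr_odd mulNr.
Qed.

Lemma Kmx_lift i j : K i (lift i j) = - (-1) ^+ i * (-1) ^+ j * \det (col' j (col' i B)).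
Proof. by rewrite mxE (negPf (neq_lift i j)) sigma_lift Delta_lift. Qed.

(** Up to sign, entry [(i, l)] is the expansion along its first row of the
    determinant of [B] without column [i] and with row [l] put on top again. *)
Lemma Kmx_mul_tr : K *m B^T = 0.
Proof.
apply/matrixP => i l; rewrite !mxE (bigD1_ord i) //= mxE eqxx mul0r add0r.
pose C : 'M[R]_(r.+1) := \matrix_(a, b)
  oapp (fun a => B a (lift i b)) (B l (lift i b)) (unlift ord0 a).
have C0 : \det C = 0.
  apply: (@determinant_alternate _ _ _ ord0 (lift ord0 l)) => //.
  by move=> j; rewrite !mxE unlift_none liftK.
transitivity (- (-1) ^+ i * \det C); last by rewrite C0 mulr0.
rewrite (expand_det_row C ord0) big_distrr /=; apply: eq_bigr => j _.
rewrite Kmx_lift !mxE unlift_none /cofactor add0n /=.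
have -> : row' ord0 (col' j C) = col' j (col' i B).
  by apply/matrixP => a b; rewrite !mxE liftK.
by ring.
Qed.


Lemma Kmx_tr : K^T = - K.
Proof.
apply/matrixP => i j; rewrite !mxE eq_sym; case: eqVneq => [_|ij]; first by rewrite oppr0.
rewrite Delta_sym -mulNr; congr (_ * _); rewrite /sigma.
by case: (ltngtP i j) => // [_|/val_inj/eqP]; rewrite ?opprK // (negPf ij).
Qed.

Lemma mulmx_Kmx : B *m K = 0.
Proof. by apply: trmx_inj; rewrite trmx_mul Kmx_tr mulNmx Kmx_mul_tr oppr0 trmx0. Qed.

Lemma scale_sub_mxE (x : R) (v y : 'cV[R]_r.+2) l : (x *: v - y) l 0 = x * v l 0 - y l 0.
Proof. by rewrite !mxE. Qed.

Section Pair.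

Variables (i : 'I_r.+2) (j : 'I_r.+1).
Local Notation N := (col' j (col' i B)).

Lemma split_pair (P : 'I_r.+2 -> Prop) :
  P i -> P (lift i j) -> (forall l, P (lift i (lift j l))) -> forall l, P l.
Proof.
move=> Pi Pj Pl l; case: (unliftP i l) => [l' ->|-> //].
by case: (unliftP j l') => [l'' ->|-> //].
Qed.

Lemma mulmx_pair0 (v : 'cV[R]_r.+2) :
  v i 0 = 0 -> v (lift i j) 0 = 0 -> B *m v = N *m row' j (row' i v).
Proof.
move=> vi vj; apply/colP => l.
rewrite (mulmx_row'_col' _ _ i) vi mulr0 add0r (mulmx_row'_col' _ _ j).
by rewrite [row' i v _ _]mxE vj mulr0 add0r.
Qed.

(** Subtract from [K i j *: v] the combination of two columns of [K] with the same
    entries in rows [i] and [j]; what is left is supported on columns of [B] that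
    are independent when [K i j] is nonzero. *)
Lemma Kmx_entry_kernel (v : 'cV[R]_r.+2) :
  B *m v = 0 -> exists u, K i (lift i j) *: v = K *m u.
Proof.
move=> Bv; have [K0|K0] := eqVneq (K i (lift i j)) 0.
  by exists 0; rewrite K0 scale0r mulmx0.
have N0 : \det N != 0 by apply: contraNneq K0; rewrite Kmx_lift => ->; rewrite mulr0.
have Kji : K (lift i j) i = - K i (lift i j).
  by have /matrixP/(_ i (lift i j)) := Kmx_tr; rewrite !mxE.
have Kd l : K l l = 0 by rewrite mxE eqxx.
pose u : 'cV[R]_r.+2 := v i 0 *: delta_mx (lift i j) 0 - v (lift i j) 0 *: delta_mx i 0.
exists u; apply/subr0_eq; set w := _ - _.
have Ku l : (K *m u) l 0 = v i 0 * K l (lift i j) - v (lift i j) 0 * K l i.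
  by rewrite mulmxBr -!scalemxAr -!colE !mxE.
have wi : w i 0 = 0 by rewrite /w scale_sub_mxE Ku Kd; ring.
have wj : w (lift i j) 0 = 0.
  by rewrite /w scale_sub_mxE Ku Kd Kji; ring.
have Bw : B *m w = 0 by rewrite mulmxBr -scalemxAr Bv mulmxA mulmx_Kmx mul0mx scaler0 subr0.
have : row' j (row' i w) = 0.
  by apply: (scale_col_inj N0); rewrite det_scale_adj -mulmx_pair0 // Bw mulmx0 scaler0.
move/colP => w'0; apply/colP; apply: split_pair => [||l]; rewrite ?wi ?wj ?mxE //.
by have := w'0 l; rewrite !mxE.
Qed.

(** Cramer's rule matches [K i j *: w] with an element of the image off the rows
    [i] and [j], and rows [i] and [j] of [K] take care of the rest. *)
Lemma Kmx_kernel_entry (w : 'cV[R]_r.+2) :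
  K *m w = 0 -> exists u, K i (lift i j) *: w = B^T *m u.
Proof.
move=> Kw; have [K0|K0] := eqVneq (K i (lift i j)) 0.
  by exists 0; rewrite K0 scale0r mulmx0.
have Kji : K (lift i j) i = - K i (lift i j).
  by have /matrixP/(_ i (lift i j)) := Kmx_tr; rewrite !mxE.
have Kd l : K l l = 0 by rewrite mxE eqxx.
pose s : R := - (-1) ^+ i * (-1) ^+ j.
pose u := s *: (\adj N^T *m row' j (row' i w)).
exists u; apply/subr0_eq; set z := _ - _.
have Kz : K *m z = 0 by rewrite mulmxBr -scalemxAr Kw mulmxA Kmx_mul_tr mul0mx scaler0 subr0.
have zl l : z (lift i (lift j l)) 0 = 0.
  rewrite /z scale_sub_mxE.
  have -> : (B^T *m u) (lift i (lift j l)) 0 = (N^T *m u) l 0.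
    by rewrite !mxE; apply: eq_bigr => c _; rewrite !mxE.
  rewrite -scalemxAr mulmxA mul_mx_adj mul_scalar_mx det_tr Kmx_lift.
  by rewrite !mxE mulrA subrr.
have row_z l : K l i * z i 0 + K l (lift i j) * z (lift i j) 0 = 0.
  have /colP/(_ l) := Kz; rewrite [RHS]mxE mxE => <-.
  by rewrite (bigD1_ord i) //= (bigD1_ord j) //= big1 ?addr0 // => c _; rewrite zl mulr0.
have zj : z (lift i j) 0 = 0.
  by have /eqP := row_z i; rewrite Kd mul0r add0r mulf_eq0 (negPf K0) => /eqP.
have zi : z i 0 = 0.
  have /eqP := row_z (lift i j); rewrite Kd mul0r addr0 Kji mulf_eq0 oppr_eq0 (negPf K0).
  by move=> /eqP.
by apply/colP; apply: split_pair => [||l]; rewrite ?zi ?zj ?zl mxE.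
Qed.

End Pair.

(** The entries of [K] above and below the diagonal are, up to sign, all the maximal
    minors of [B]: a choice of [r] columns misses two. *)
Lemma minors_ideal_entries (I : R -> Prop) :
    is_ideal I -> (forall i j, I (K i (lift i j))) -> ideal_le (minors_ideal r B) I.
Proof.
move=> hI IK x Ix; apply: Ix => // {}x [f [g [_ _ ->]]].
have [i [s gs]] := missing_index_lift g (leqnSn r).
have [j [t st]] := missing_index_lift s (leqnn r).
have [c ->] := @det_factor_mxsub _ r _ _ B f id g (fun l => lift i (lift j l)) f t
  (fun=> erefl) (fun l => etrans (gs l) (congr1 (lift i) (st l))).
have -> : mxsub id (fun l => lift i (lift j l)) B = col' j (col' i B).
  by apply/matrixP => a b; rewrite !mxE.
have := IK i j; rewrite Kmx_lift => Id; case: hI => _ _ IM.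
pose s0 : R := - (-1) ^+ i * (-1) ^+ j.
have s0K : s0 * s0 = 1 by rewrite mulrACA mulrNN -!expr2 !sqrr_sign mulr1.
have -> : c * \det (col' j (col' i B)) = c * s0 * (s0 * \det (col' j (col' i B))).
  by rewrite -mulrA [s0 * (s0 * _)]mulrA s0K mul1r.
exact: IM.
Qed.

(** Exactness of the Buchsbaum-Rim complex of [B]: its homology is annihilated by [a],
    [b] and [c], so exactness propagates from left to right, one more element of
    the regular sequence being used at each step. *)
Lemma buchsbaum_rim a b c :
    minors_ideal r B a -> minors_ideal r B b -> minors_ideal r B c ->
    regular [:: c; b; a] ->
  [/\ injective_mx B^T, exact_at K B^T & exact_at B K].
Proof.
move=> Ia Ib Ic reg; have [[/regular_head_neq0 a0 _] _] := reg.
have inj : injective_mx B^T.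
  have [f [g N0]] := minors_ideal_neq0 Ia a0.
  by apply: (@minor_injective _ _ _ _ g f); rewrite -trmx_mxsub det_tr.
have exB (v : 'cV_r.+2) x : B *m v = 0 -> minors_ideal r B x -> exists u, x *: v = K *m u.
  move=> Bv; apply: (@minors_ideal_entries (fun x => exists u, x *: v = K *m u) _ _ x).
    exact: scale_image_ideal.
  by move=> i j; apply: Kmx_entry_kernel.
have exK (v : 'cV_r.+2) x : K *m v = 0 -> minors_ideal r B x -> exists u, x *: v = B^T *m u.
  move=> Kv; apply: (@minors_ideal_entries (fun x => exists u, x *: v = B^T *m u) _ _ x).
    exact: scale_image_ideal.
  by move=> i j; apply: Kmx_kernel_entry.
have exKB : exact_at K B^T.
  move=> v; split=> [Kv|[u ->]]; last by rewrite mulmxA Kmx_mul_tr mul0mx.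
  have [y ay] := exK v a Kv Ia; have [z bz] := exK v b Kv Ib.
  by apply: (regular2_image inj _ ay bz); case: (reg).
split=> // v; split=> [Bv|[u ->]]; last by rewrite mulmxA mulmx_Kmx mul0mx.
have [y ay] := exB v a Bv Ia; have [z bz] := exB v b Bv Ib.
have [t ct] := exB v c Bv Ic.
exact: regular3_image inj exKB reg ay bz ct.
Qed.

End BuchsbaumRim.


(** * Degrees *)

Section Degrees.

Variables (n : nat) (k : fieldType).
Local Notation R := {mpoly k[n]}.

(** [x] has degree [a - b], with the convention that only 0 has negative degree;
    keeping [a] and [b] apart avoids truncated subtraction. *)
Definition homog_diff (a b : nat) (x : R) : bool :=
  if (b <= a)%N then x \is (a - b).-homog else x == 0.

Lemma homog_diff0 a b : homog_diff a b 0.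
Proof. by rewrite /homog_diff; case: ifP; rewrite ?dhomog0 ?eqxx. Qed.

Lemma homog_diffD a b x y : homog_diff a b x -> homog_diff a b y -> homog_diff a b (x + y).
Proof.
rewrite /homog_diff; case: ifP => _; first exact: dhomogD.
by move=> /eqP-> /eqP->; rewrite addr0.
Qed.

Lemma homog_diff_sum (I : Type) (s : seq I) (P : pred I) a b (F : I -> R) :
  (forall i, P i -> homog_diff a b (F i)) -> homog_diff a b (\sum_(i <- s | P i) F i).
Proof. by move=> HF; elim/big_ind: _ => //; [apply: homog_diff0|apply: homog_diffD]. Qed.

Lemma homog_diffM a b c d x y :
  homog_diff a b x -> homog_diff c d y -> homog_diff (a + c) (b + d) (x * y).
Proof.
rewrite {1 2}/homog_diff; case: leqP => [ba|_ /eqP->]; last by rewrite mul0r homog_diff0.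
case: leqP => [dc|_ _ /eqP->]; last by rewrite mulr0 homog_diff0.
move=> xh yh; rewrite /homog_diff leq_add //.
have -> : (a + c - (b + d) = (a - b) + (c - d))%N by lia.
exact: dhomogM.
Qed.

Lemma homog_diff_eq a b c d x : (a + d = c + b)%N -> homog_diff c d x -> homog_diff a b x.
Proof.
move=> e; rewrite /homog_diff; have -> : (d <= c)%N = (b <= a)%N by apply/idP/idP; lia.
by have -> : (c - d = a - b)%N by lia.
Qed.

Lemma homog_diff_sign i : homog_diff 0 0 ((-1) ^+ i).
Proof.
by rewrite /homog_diff /= subnn -signr_odd; case: (odd i); rewrite ?expr1 ?dhomogN dhomog1.
Qed.

(** Every term of the determinant has the same degree, since a permutation does not
    change the sum of the column degrees. *)
Lemma homog_diff_det m (rho gamma : 'I_m -> nat) (M : 'M[R]_m) :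
    (forall i j, homog_diff (rho i) (gamma j) (M i j)) ->
  homog_diff (\sum_i rho i) (\sum_j gamma j) (\det M).
Proof.
move=> HM; apply: homog_diff_sum => s _.
rewrite -[(\sum_i rho i)%N]add0n -[(\sum_j gamma j)%N]add0n.
apply: homog_diffM; first exact: homog_diff_sign.
rewrite [(\sum_j gamma j)%N](reindex_inj (@perm_inj _ s)) /=.
elim/big_rec3: _ => [|i b a x _ IH]; first exact: (homog_diff_sign 0).
exact: homog_diffM.
Qed.

Lemma graded_map_homog p q (s : 'I_p -> nat) (t : 'I_q -> nat) (M : 'M[R]_(p, q)) :
  (forall i j, homog_diff (t j) (s i) (M i j)) -> graded_map s t M.
Proof.
move=> HM e v Hv i; rewrite mxE; apply: homog_diff_sum => j _.
by apply: homog_diff_eq (homog_diffM (HM i j) (Hv j)); lia.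
Qed.

Lemma irrelevant_homog e (x : R) : (0 < e)%N -> x \is e.-homog -> irrelevant_ideal x.
Proof.
move=> e0 /dhomogP xh; have [I0 ID IM] := ideal_gen_ideal (fun x : R => exists i : 'I_n, x = 'X_i).
rewrite [x]mpolyE big_seq; elim/big_ind: _ => // m /xh /= me.
have [i mi] : exists i, m i != 0%N.
  apply/existsP; move: e0; rewrite -me mdegE lt0n; apply: contraNT.
  rewrite negb_exists => /forallP m0; apply/eqP/big1 => i _.
  by apply/eqP; have := m0 i; rewrite negbK.
have -> : x@_m *: 'X_[m] = (x@_m *: 'X_[m - U_(i)]) * 'X_i.
  by rewrite -scalerAl -mpolyXD submK // lep1mP.
by apply: IM => I _; apply; exists i.
Qed.

Lemma irrelevant_homog_diff a b (x : R) : (b < a)%N -> homog_diff a b x -> irrelevant_ideal x.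
Proof.
by move=> ba; rewrite /homog_diff ltnW //; apply: irrelevant_homog; rewrite subn_gt0.
Qed.

Lemma minimal_map_entries p q (M : 'M[R]_(p, q)) :
  (forall i j, irrelevant_ideal (M i j)) -> minimal_map M.
Proof.
move=> HM v i; have [I0 ID IM] := ideal_gen_ideal (fun x : R => exists i : 'I_n, x = 'X_i).
rewrite mxE; elim/big_ind: _ => // j _; rewrite mulrC; exact: IM (HM i j).
Qed.

Lemma maximal_minors_homog m (rho : 'I_m.+1 -> nat) (gamma : 'I_m -> nat)
    (M : 'M[R]_(m.+1, m)) i e :
    (forall l j, homog_diff (rho l) (gamma j) (M l j)) ->
    (\sum_l rho l = e + rho i + \sum_j gamma j)%N ->
  homog_diff e 0 (maximal_minors M 0 i).
Proof.
move=> HM; rewrite (bigD1_ord i) //= => e_rho; rewrite mxE.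
have Hd : homog_diff (\sum_l rho (lift i l)) (\sum_j gamma j) (\det (row' i M)).
  by apply: homog_diff_det => l j; rewrite mxE.
apply: homog_diff_eq (homog_diffM (homog_diff_sign i) Hd).
by move: e_rho; rewrite addn0 !add0n -addnA addnCA => /addnI ->.
Qed.

Lemma Kmx_homog r (rho : 'I_r -> nat) (gamma : 'I_r.+2 -> nat) (B : 'M[R]_(r, r.+2)) d i j :
    (forall l j, homog_diff (rho l) (gamma j) (B l j)) ->
    (\sum_j gamma j = d + \sum_l rho l)%N ->
  homog_diff (gamma i + gamma j) d (Kmx B i j).
Proof.
move=> HB; case: (unliftP i j) => [j' ->|<-]; last by rewrite mxE eqxx homog_diff0.
rewrite (bigD1_ord i) //= (bigD1_ord j') //= Kmx_lift => e.
have Hd : homog_diff (\sum_l rho l) (\sum_l gamma (lift i (lift j' l))) (\det (col' j' (col' i B))).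
  by apply: homog_diff_det => a b; rewrite !mxE.
have -> : - (-1) ^+ i * (-1) ^+ j' = (-1) ^+ (i + j').+1 :> R.
  by rewrite exprS mulN1r exprD mulNr.
apply: homog_diff_eq (homog_diffM (homog_diff_sign _) Hd).
by rewrite !add0n -addnA e addnC.
Qed.

End Degrees.

(** * The resolution *)

Lemma height_ge_chain n (k : fieldType) (I : {mpoly k[n]} -> Prop) h :
  height I h -> forall P, prime_ideal P -> ideal_le I P -> prime_chain_to P h.
Proof. by case. Qed.

Section Level.

Variables (k : fieldType) (n d r : nat) (delta : 'I_r.+2 -> nat) (eps : 'I_r -> nat).
Local Notation R := {mpoly k[n]}.
Variables (A : 'M[R]_(3, r.+2)) (B : 'M[R]_(r, r.+2)).

Local Notation eta := (col_mx A B : 'M[R]_(r.+3, r.+2)).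

Lemma fixing_minorsE : fixing_minors A B = lsubmx (maximal_minors eta : 'rV[R]_(3 + r)).
Proof. by apply/rowP => i; rewrite !mxE. Qed.

Lemma fixing_minors_mulmx :
  fixing_minors A B *m A + rsubmx (maximal_minors eta : 'rV[R]_(3 + r)) *m B = 0.
Proof.
by rewrite fixing_minorsE -mul_row_col hsubmxK; apply: maximal_minors_mulmx.
Qed.

(** A syzygy [v] of the fixing minors, extended by zeros, is a syzygy of all the
    maximal minors, so it is [A *m u] with [B *m u = 0]. *)
Lemma fixing_minors_exact :
  exact_at (maximal_minors eta) eta -> exact_at B (Kmx B) ->
  exact_at (fixing_minors A B) (A *m Kmx B).
Proof.
move=> ex_eta ex_B v; split=> [pv|[u ->]]; last first.
  rewrite -mulmxA mulmxA.
  have -> : fixing_minors A B *m A = - (rsubmx (maximal_minors eta : 'rV[R]_(3 + r)) *m B).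
    by apply/eqP; rewrite -addr_eq0 fixing_minors_mulmx.
  by rewrite mulNmx -mulmxA (mulmxA B) mulmx_Kmx mul0mx mulmx0 oppr0.
have : maximal_minors eta *m (col_mx v 0 : 'cV[R]_(r.+3)) = 0.
  have -> : maximal_minors eta = row_mx (fixing_minors A B)
      (rsubmx (maximal_minors eta : 'rV[R]_(3 + r))) :> 'rV[R]_(3 + r).
    by rewrite fixing_minorsE hsubmxK.
  by rewrite (mul_row_col (fixing_minors A B)) pv mulmx0 addr0.
move=> /(ex_eta (col_mx v 0 : 'cV[R]_(r.+3)))[u]; rewrite (mul_col_mx A) => e.
have [-> /esym Bu] : v = A *m u /\ 0 = B *m u by apply: (@eq_col_mx R 3 r 1) e.
by have [w ->] := (ex_B u).1 Bu; exists w; rewrite mulmxA.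
Qed.

Lemma mul_Kmx_exact :
  injective_mx eta -> exact_at (Kmx B) B^T -> exact_at (A *m Kmx B) B^T.
Proof.
move=> inj_eta ex_K v; split=> [AKv|[u ->]]; last first.
  by rewrite -mulmxA (mulmxA (Kmx B)) Kmx_mul_tr mul0mx mulmx0.
apply/(ex_K v)/inj_eta; rewrite (mul_col_mx A) mulmxA AKv mulmxA mulmx_Kmx mul0mx.
exact: (@col_mx0 _ 3 r 1).
Qed.

Hypothesis hlatent : latent_data d delta eps.
Hypothesis hlevel : level_matrix d delta eps A B.

Definition row_degree (i : 'I_(3 + r)) : nat :=
  match split i with inl _ => d | inr j => delta (rshift 2 j) + eps j end.

Lemma level_homog_A l j : homog_diff d (delta j) (A l j).
Proof. exact: (level_a hlevel l j). Qed.

Lemma level_homog_B i j : homog_diff (delta (rshift 2 i) + eps i) (delta j) (B i j).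
Proof.
have := level_b hlevel i j; rewrite /homog_diff; by case: ltngtP => // _ /eqP->; rewrite dhomog0.
Qed.

(** Condition (2) on latent data, in the form that makes the degrees of all the
    maximal minors come out right. *)
Lemma sum_delta : (\sum_j delta j = d + \sum_j (delta (rshift 2 j) + eps j))%N.
Proof.
rewrite big_split /= !big_ord_recl addnA.
have := latent2 hlatent.
have -> : inord 0 = ord0 :> 'I_r.+2 by apply/val_inj; rewrite /= inordK.
have -> : inord 1 = lift ord0 ord0 :> 'I_r.+2 by apply/val_inj; rewrite /= inordK.
move=> ->; rewrite -addnA; congr (_ + _)%N.
by rewrite addnC; congr (_ + _)%N; apply: eq_bigr => i _; congr delta; apply/val_inj.
Qed.

Lemma fixing_minors_homog i : homog_diff d 0 (fixing_minors A B 0 i).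
Proof.
have -> : fixing_minors A B 0 i = maximal_minors eta 0 (lshift r i) by rewrite !mxE.
apply: (@maximal_minors_homog _ _ _ row_degree delta) => [l j|].
  rewrite /row_degree mxE; case: split => l'; [exact: level_homog_A|exact: level_homog_B].
have row_l (l : 'I_3) : row_degree (lshift r l) = d by rewrite /row_degree (unsplitK (inl l)).
have row_r (l : 'I_r) : row_degree (rshift 3 l) = (delta (rshift 2 l) + eps l)%N.
  by rewrite /row_degree (unsplitK (inr l)).
rewrite (@big_split_ord _ _ _ 3 r) /= sum_delta !(eq_bigr _ (fun l _ => row_r l)).
rewrite row_l (eq_bigr _ (fun l _ => row_l l)) sum_nat_const card_ord.
by rewrite !mulSn mul0n addn0 !addnA.
Qed.

Lemma level_Kmx_homog i j : homog_diff (delta i + delta j) d (Kmx B i j).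
Proof. exact: Kmx_homog level_homog_B sum_delta. Qed.

Lemma level_AK_homog l j : homog_diff (d + delta j) d ((A *m Kmx B) l j).
Proof.
rewrite mxE; apply: homog_diff_sum => i _.
by apply: homog_diff_eq (homog_diffM (level_homog_A l i) (level_Kmx_homog i j)); lia.
Qed.

End Level.

Theorem proposition3p6 (k : fieldType) (n : nat) (hn : (3 <= n)%N)
    (d r : nat) (delta : 'I_r.+2 -> nat) (eps : 'I_r -> nat)
    (hlatent : latent_data d delta eps)
    (A : 'M[{mpoly k[n]}]_(3, r.+2)) (B : 'M[{mpoly k[n]}]_(r, r.+2))
    (hlevel : level_matrix d delta eps A B) :
  minimal_graded_free_resolution
    (ideal_gen (fun x => exists i : 'I_3, x = fixing_minors A B 0 i))
    (fun _ : 'I_3 => d)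
    (fun i : 'I_r.+2 => (d + delta i)%N)
    (fun j : 'I_r => (d + delta (rshift 2 j) + eps j)%N)
    (fixing_minors A B) (A *m Kmx B) B^T.
Proof.
have [s [s2 sI s_reg]] := regular_of_height (ltnW hn) (ideal_gen_ideal _)
  (height_ge_chain (level_ht_eta hlevel)).
have [t [t3 tI t_reg]] := regular_of_height hn (ideal_gen_ideal _)
  (height_ge_chain (level_ht_B hlevel)).
case: s s2 sI s_reg => [|b [|a []]] //= _ sI s_reg.
case: t t3 tI t_reg => [|z [|y [|x []]]] //= _ tI t_reg.
have [Ia Ib] : minors_ideal r.+2 (col_mx A B) a /\ minors_ideal r.+2 (col_mx A B) b.
  by split; apply: sI; rewrite !inE eqxx ?orbT.
have [inj_B exK exB] : [/\ injective_mx B^T, exact_at (Kmx B) B^T & exact_at B (Kmx B)].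
  by apply: buchsbaum_rim t_reg; apply: tI; rewrite !inE eqxx ?orbT.
have a0 : a != 0 by apply: regular_head_neq0; case: s_reg.
have ex_eta := hilbert_burch Ia Ib s_reg.
have inj_eta := minors_ideal_injective Ia a0.
split.
- by apply: graded_map_homog => i j; rewrite ord1; apply: fixing_minors_homog hlatent hlevel j.
- exact: graded_map_homog (level_AK_homog hlatent hlevel).
- apply: graded_map_homog => i j; rewrite mxE; have := level_homog_B hlevel j i.
  by apply: homog_diff_eq; lia.
- move=> x0; split=> [Jx|[v ->] J [J0 JD JM] GJ].
    apply: (Jx (fun y => exists v : 'cV_3, y = (fixing_minors A B *m v) 0 0)) => [|_ [i ->]].
      split=> [|u v [u' ->] [v' ->]|c u [u' ->]].
      + by exists 0; rewrite mulmx0 mxE.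
      + by exists (u' + v'); rewrite mulmxDr [in RHS]mxE.
      + by exists (c *: u'); rewrite -scalemxAr [in RHS]mxE.
    by exists (delta_mx i 0); rewrite -colE [RHS]mxE.
  rewrite mxE; elim/big_ind: _ => // j _; rewrite mulrC; apply: JM; apply: GJ.
  by exists j.
- exact: fixing_minors_exact ex_eta exB.
- exact: mul_Kmx_exact inj_eta exK.
- exact: inj_B.
- apply: minimal_map_entries => i j; rewrite ord1.
  exact: irrelevant_homog_diff (latent_d hlatent) (fixing_minors_homog hlatent hlevel j).
- apply: minimal_map_entries => i j.
  apply: irrelevant_homog_diff (level_AK_homog hlatent hlevel i j).
  by have := latent_delta hlatent j; lia.
- apply: minimal_map_entries => i j; rewrite mxE; have := level_b hlevel j i.
  case: ifP => [lt|_ /eqP->]; first by apply: irrelevant_homog; rewrite subn_gt0.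
  by case: (ideal_gen_ideal (fun x : {mpoly k[n]} => exists i : 'I_n, x = 'X_i)).
Qed.
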